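(* Let $\Lambda$ be an artin algebra, let $P$ be a projective module in $\Lambda\text{-}\mathrm{mod}$, and let $\Gamma=\mathrm{End}_{\Lambda}(P)^{op}$ be its endomorphism algebra. Let $m\geqslant 0$ be an integer. If $\Lambda$ is an $(m,j)$-Igusa-Todorov algebra for some $j\in\{0,1,2\}$, then $\Gamma$ is also an $(m,j)$-Igusa-Todorov algebra (for the same $m$ and $j$).
   Context: For an artin algebra $\Lambda$, $\Lambda\text{-}\mathrm{mod}$ denotes the category of finitely generated left $\Lambda$-modules. For a module $V$, $\mathrm{add}\,V$ is the full subcategory of direct summands of finite direct sums of copies of $V$. For $X\in\Lambda\text{-}\mathrm{mod}$ with projective cover $g:P_X\to X$, set $\Omega^1_\Lambda(X)=\mathrm{Ker}\, g$, $\Omega^0_\Lambda(X)=X$, and $\Omega^n_\Lambda(X)=\Omega^1_\Lambda(\Omega^{n-1}_\Lambda(X))$ for $n\geqslant 2$. Let $m,n$ be non-negative integers. An artin algebra $\Lambda$ is called an $(m,n)$-Igusa-Todorov algebra (or $(m,n)$-IT algebra) if there is a module $V\in\Lambda\text{-}\mathrm{mod}$ such that for every module $M\in\Lambda\text{-}\mathrm{mod}$ there exists an exact sequence $$0\to V_m\to V_{m-1}\to\cdots\to V_1\to V_0\to\Omega^n_\Lambda(M)\to 0$$ with $V_i\in\mathrm{add}\,V$ for each $0\leqslant i\leqslant m$. *)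

(* Defs.v *)
From HB Require Import structures.
From mathcomp Require Import all_boot all_order all_algebra.
From mathcomp Require Import boolp classical_sets.

Set Implicit Arguments.
Unset Strict Implicit.
Unset Printing Implicit Defensive.

Import GRing.Theory.
Local Open Scope ring_scope.
Local Open Scope classical_set_scope.

(* Rings are [pzRingType] (unital, possibly zero): the endomorphism ring of the
   zero module is the zero ring, which is not an [nzRingType].  A left module
   over [R] is an [lmodType R]. *)

Section Modules.
Variable R : pzRingType.
Implicit Types (M N P V X Y : lmodType R).

Definition surj (M N : Type) (f : M -> N) : Prop := forall y, exists x, f x = y.

Definition exact_at M N X (f : {linear M -> N}) (g : {linear N -> X}) : Prop :=
  forall y, g y = 0 <-> exists x, f x = y.

Definition isomorphic M N : Prop := exists f : {linear M -> N}, bijective f.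

Definition submodule M (N : set M) : Prop :=
  [/\ N 0, forall x y, N x -> N y -> N (x + y)
    & forall a x, N x -> N (a *: x)].

Definition artinian_module M : Prop :=
  forall N : nat -> set M,
    (forall i, submodule (N i)) -> (forall i, N i.+1 `<=` N i) ->
    exists i, forall j, (i <= j)%N -> N j = N i.

Definition fin_gen M : Prop :=
  exists (n : nat) (g : 'I_n -> M),
    forall x, exists c : 'I_n -> R, x = \sum_(i < n) c i *: g i.

Definition projective P : Prop :=
  forall M N (g : {linear M -> N}) (f : {linear P -> N}), surj g ->
    exists h : {linear P -> M}, forall x, g (h x) = f x.

Definition superfluous M (K : set M) : Prop :=
  forall N : set M, submodule N ->
    (forall x, exists y z, [/\ N y, K z & x = y + z]) -> forall x, N x.

Definition projective_cover P X (g : {linear P -> X}) : Prop :=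
  [/\ fin_gen P, projective P, surj g & superfluous [set x | g x = 0]].

(* [is_syzygy n M K]: the module [K] is (isomorphic to) Omega^n(M).  Projective
   covers, hence syzygies, are determined up to isomorphism only. *)
Fixpoint is_syzygy (n : nat) M (K : lmodType R) : Prop :=
  match n with
  | 0 => isomorphic K M
  | n'.+1 => exists (Y P : lmodType R) (g : {linear P -> Y})
                    (i : {linear K -> P}),
      [/\ is_syzygy n' M Y, projective_cover g, injective i & exact_at i g]
  end.

Definition in_add V X : Prop :=
  exists (n : nat) (Y : lmodType R), isomorphic (X * Y)%type {ffun 'I_n -> V}.

(* An exact sequence 0 -> W_m -> ... -> W_0 -> X -> 0 with terms in add V,
   written as a sequence indexed by [nat] with W_i = 0 for i > m; exactness at
   W_m then says that W_m -> W_(m-1) (W_0 -> X if m = 0) is injective. *)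
Definition add_resolution (m : nat) V X : Prop :=
  exists (W : nat -> lmodType R) (d : forall i, {linear W i.+1 -> W i})
         (e : {linear W 0 -> X}),
    [/\ forall i, (i <= m)%N -> in_add V (W i),
        forall i, (m < i)%N -> forall x : W i, x = 0,
        surj e, exact_at (d 0) e
      & forall i, exact_at (d i.+1) (d i)].

End Modules.

(* An associative unital k-algebra, possibly zero (mathcomp's [algType k]
   excludes the zero algebra). *)
Record algebra (k : comPzRingType) := Algebra {
  alg_ring :> pzRingType;
  alg_map : {rmorphism k -> alg_ring};
  alg_mapC : forall (r : k) (a : alg_ring), alg_map r * a = a * alg_map r
}.

Definition artin_algebra (k : comPzRingType) (A : algebra k) : Prop :=
  artinian_module k^o /\
  exists (n : nat) (g : 'I_n -> A),
    forall a, exists c : 'I_n -> k, a = \sum_(i < n) alg_map A (c i) * g i.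

Definition igusa_todorov (m n : nat) (k : comPzRingType) (A : algebra k) : Prop :=
  artin_algebra A /\
  exists V : lmodType A, fin_gen V /\
    forall M : lmodType A, fin_gen M ->
      exists K : lmodType A, is_syzygy n M K /\ add_resolution m V K.

Section EndomorphismRing.
Variables (R : pzRingType) (P : lmodType R).

Definition endo := {linear P -> P}.

HB.instance Definition _ := gen_eqMixin endo.
HB.instance Definition _ := gen_choiceMixin endo.

Lemma endoP (f g : endo) : f =1 g -> f = g.
Proof.
case: f g => f [[fD] [fZ]] [g [[gD] [gZ]]] /= /funext fg.
by case: _ / fg in gD gZ *; rewrite (Prop_irrelevance fD gD) (Prop_irrelevance fZ gZ).
Qed.

Definition endo_zero : endo := \0.
Definition endo_opp (f : endo) : endo := -%R \o f.
Definition endo_add (f g : endo) : endo := f \+ g.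
Definition endo_one : endo := idfun.
Definition endo_mul (f g : endo) : endo := f \o g.

Fact endo_addA : associative endo_add.
Proof. by move=> f g h; apply: endoP => x /=; rewrite addrA. Qed.
Fact endo_addC : commutative endo_add.
Proof. by move=> f g; apply: endoP => x /=; rewrite addrC. Qed.
Fact endo_add0 : left_id endo_zero endo_add.
Proof. by move=> f; apply: endoP => x /=; rewrite add0r. Qed.
Fact endo_addN : left_inverse endo_zero endo_opp endo_add.
Proof. by move=> f; apply: endoP => x /=; rewrite addNr. Qed.

HB.instance Definition _ :=
  GRing.isZmodule.Build endo endo_addA endo_addC endo_add0 endo_addN.

Fact endo_mulA : associative endo_mul.
Proof. by move=> f g h; apply: endoP. Qed.
Fact endo_mul1l : left_id endo_one endo_mul.
Proof. by move=> f; apply: endoP. Qed.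
Fact endo_mul1r : right_id endo_one endo_mul.
Proof. by move=> f; apply: endoP. Qed.
Fact endo_mulDl : left_distributive endo_mul endo_add.
Proof. by move=> f g h; apply: endoP. Qed.
Fact endo_mulDr : right_distributive endo_mul endo_add.
Proof. by move=> f g h; apply: endoP => x /=; rewrite linearD. Qed.

HB.instance Definition _ :=
  GRing.Zmodule_isPzRing.Build endo
    endo_mulA endo_mul1l endo_mul1r endo_mulDl endo_mulDr.

End EndomorphismRing.

(* End_A(P)^op: the multiplication of [(endo P)^c] is f * g = g \o f, and k acts
   on P through k -> A. *)
Section EndomorphismAlgebra.
Variables (k : comPzRingType) (A : algebra k) (P : lmodType A).

Definition endo_op_map_fun (r : k) (x : P) : P := alg_map A r *: x.

Fact endo_op_map_linear (r : k) : linear (endo_op_map_fun r).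
Proof.
by move=> a x y; rewrite /endo_op_map_fun scalerDr !scalerA alg_mapC.
Qed.

HB.instance Definition _ (r : k) :=
  GRing.isLinear.Build A P P *:%R (endo_op_map_fun r) (endo_op_map_linear r).

Definition endo_op_map (r : k) : (endo P)^c := (endo_op_map_fun r : {linear P -> P}).

Fact endo_op_map_additive : zmod_morphism endo_op_map.
Proof.
by move=> r s; apply: endoP => x; rewrite /= /endo_op_map_fun rmorphB scalerBl.
Qed.

Fact endo_op_map_multiplicative : monoid_morphism endo_op_map.
Proof.
split=> [|r s]; apply: endoP => x; rewrite /= /endo_op_map_fun.
  by rewrite rmorph1 scale1r.
by rewrite mulrC rmorphM scalerA.
Qed.

HB.instance Definition _ :=
  GRing.isZmodMorphism.Build k (endo P)^c endo_op_map endo_op_map_additive.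
HB.instance Definition _ :=
  GRing.isMonoidMorphism.Build k (endo P)^c endo_op_map
    endo_op_map_multiplicative.

Fact endo_op_mapC (r : k) (f : (endo P)^c) :
  endo_op_map r * f = f * endo_op_map r.
Proof.
by apply: endoP => x; rewrite /= /endo_op_map_fun linearZ.
Qed.

Definition endo_op : algebra k := @Algebra k (endo P)^c endo_op_map endo_op_mapC.

End EndomorphismAlgebra.

(* Main.v *)
Require Import Defs.
From HB Require Import structures.
From mathcomp Require Import all_boot all_order all_algebra.
From mathcomp Require Import boolp classical_sets.

(** Write Gamma for End(P)^op.  The functor F = Hom(P, -) from Lambda-modules to
    Gamma-modules is exact, because P is projective, and it commutes with finite
    direct sums.  So it sends an add V-resolution of K to an add F(V)-resolution
    of F(K), and everything reduces to writing the j-th syzygy of an arbitrary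
    finitely generated Gamma-module N as F of the j-th syzygy of some finitely
    generated Lambda-module X.

    Such an X comes from a presentation of N by copies of Gamma = F(P): if
    F(P^n) = Gamma^n -> N is onto with kernel K, divide P^n by the submodule T
    generated by the images of the maps in K.  Then F(X) = N, because every map
    P -> P^n with values in T already lies in K; this converse ([trace_hom]) is
    where P being finitely generated and projective matters most.

    Call a module P-generated if the images of the maps from P generate it.  If
    Q -> X is a projective cover and X is P-generated, then superfluousness of
    the kernel makes Q P-generated too, so that Q is a summand of a power of P
    and F(Q) is a projective Gamma-module; and F(Q) -> F(X) is again a projective
    cover ([hom_cover]), since a submodule of F(Q) is recovered from the submodule
    of Q that it generates.  Hence F carries a syzygy of X to a syzygy of F(X)
    whenever X is P-generated.  The X constructed above is P-generated, being a
    quotient of P^n, and so is its first syzygy, because the kernel T of P^n -> X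
    is P-generated and maps onto that syzygy ([cover_kernel_generated]).  The
    second syzygy of X need not be P-generated, and this is why the argument
    stops at j = 2.

    Finite generation is handled by a dual basis e_i, phi_i of P, with
    x = sum_i phi_i(x) e_i: a map h out of P is the sum of the rank one maps
    x |-> phi_i(x) h(e_i), so that maps out of P are built and recognised one
    rank one map at a time.  The same formula shows that F(V) and Gamma are
    finitely generated over the base ring k. *)

Set Implicit Arguments.
Unset Strict Implicit.
Unset Printing Implicit Defensive.

(** * Submodules, isomorphisms and quotients *)

Section Generalities.
Import GRing.Theory.
Local Open Scope ring_scope.
Local Open Scope classical_set_scope.
Variable R : pzRingType.
Implicit Types (M N Q X Y : lmodType R).

Lemma submodule_sum M (N : set M) (I : Type) (s : seq I) (F : I -> M) :
  submodule N -> (forall i, N (F i)) -> N (\sum_(i <- s) F i).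
Proof. by case=> N0 ND _ NF; elim/big_ind: _ => // *; apply: ND. Qed.

Lemma submodule_opp M (N : set M) : submodule N -> forall x, N x -> N (- x).
Proof. by case=> _ _ NZ x Nx; rewrite -scaleN1r; apply: NZ. Qed.

Lemma submodule_sub M (N : set M) :
  submodule N -> forall x y, N x -> N y -> N (x - y).
Proof.
by move=> sN x y Nx Ny; case: (sN) => _ ND _; apply: ND => //; apply: submodule_opp.
Qed.

Lemma submodule_setT M : submodule [set: M].
Proof. by []. Qed.

Lemma submodule_preim M N (f : {linear M -> N}) (A : set N) :
  submodule A -> submodule (f @^-1` A).
Proof.
case=> A0 AD AZ; split=> [|x y|a x] /=; first by rewrite linear0.
  by rewrite linearD; apply: AD.
by rewrite linearZ; apply: AZ.
Qed.

Lemma submodule_kernel M N (f : {linear M -> N}) : submodule [set x | f x = 0].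
Proof.
split=> [|x y|a x] /=; rewrite ?linear0 ?linearD ?linearZ //= => ->.
  by move=> ->; rewrite addr0.
by rewrite scaler0.
Qed.

Lemma submodule_image M N (f : {linear M -> N}) (A : set M) :
  submodule A -> submodule (f @` A).
Proof.
case=> A0 AD AZ; split=> [|_ _ [x Ax <-] [y Ay <-]|a _ [x Ax <-]].
- by exists 0; rewrite ?linear0.
- by exists (x + y); rewrite ?linearD //; apply: AD.
- by exists (a *: x); rewrite ?linearZ //; apply: AZ.
Qed.

(** The image of [f] and the superfluous kernel of [g] together span [Q]. *)
Lemma surj_of_cover_comp M Q X (f : {linear M -> Q}) (g : {linear Q -> X}) :
  superfluous [set x | g x = 0] -> surj (g \o f) -> surj f.
Proof.
move=> sup gf_surj.
suff im x : (f @` setT) x by move=> x; have [y _ <-] := im x; exists y.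
apply: sup; first exact/submodule_image/submodule_setT.
move=> {}x; have [y gfy] := gf_surj (g x).
exists (f y), (x - f y); split; first by exists y.
  by rewrite /= linearB -gfy subrr.
by rewrite addrC subrK.
Qed.

(** Two surjections with the same kernel have isomorphic targets, both being the
    quotient by that kernel. *)
Lemma linear_factor_kernel M N X (p : {linear M -> N}) (q : {linear M -> X}) :
  surj p -> surj q -> (forall x, p x = 0 <-> q x = 0) -> isomorphic N X.
Proof.
move=> p_surj q_surj ker_pq.
have [s ps] := choice p_surj; have [t qt] := choice q_surj.
have pq x y : p x = p y <-> q x = q y.
  split=> /eqP; rewrite -subr_eq0 -linearB => /eqP/ker_pq/eqP;
    by rewrite linearB subr_eq0 => /eqP.
have sE x : q (s (p x)) = q x by apply/pq; rewrite ps.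
have lin : linear (q \o s).
  move=> a x y; rewrite -[x]ps -[y]ps -linearP /=.
  by rewrite !sE linearP.
pose f := GRing.isLinear.Build R N X *:%R (q \o s) lin.
pose F : {linear N -> X} := HB.pack (q \o s) f.
exists F; exists (p \o t) => x /=.
  by rewrite -[RHS]ps; apply/pq; rewrite qt.
by rewrite -[RHS]qt; apply/pq; rewrite ps.
Qed.

Lemma isomorphic_sym M N : isomorphic M N -> isomorphic N M.
Proof.
case=> f fbij; apply: (@linear_factor_kernel M N M f idfun).
- by case: fbij => g _ gK y; exists (g y).
- by move=> y; exists y.
- move=> x; split=> [fx0|/= ->]; last exact: linear0.
  by apply: (bij_inj fbij); rewrite linear0.
Qed.

Lemma isomorphic_trans M N X :
  isomorphic M N -> isomorphic N X -> isomorphic M X.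
Proof. by case=> f fbij [g gbij]; exists (g \o f); apply: bij_comp. Qed.

Lemma linear_bij_isomorphic M N (f : {linear M -> N}) :
  injective f -> surj f -> isomorphic M N.
Proof.
move=> f_inj f_surj; have [g gP] := choice f_surj.
by exists f, g => // x; apply: f_inj; rewrite gP.
Qed.

Section Quotient.
Variables (M : lmodType R) (T : set M).
Hypothesis sT : submodule T.

(** Since [choose] depends only on the extension of the predicate, this picks the
    same element for all members of a coset, so cosets can be represented by the
    fixed points of [coset_repr]. *)
Definition coset_repr (x : M) : M := choose (fun y => `[< T (x - y) >]) x.

Lemma coset_reprP x : T (x - coset_repr x).
Proof.
apply/asboolP/(@chooseP _ (fun y => `[< T (x - y) >])); apply/asboolP.
by rewrite subrr; case: sT.
Qed.

Lemma coset_repr_eq x y : T (x - y) <-> coset_repr x = coset_repr y.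
Proof.
split=> [Txy|eq_xy].
  rewrite /coset_repr (@choose_id _ (fun z => `[< T (y - z) >]) y x).
  - apply: eq_choose => z; apply/asbool_equiv_eq; split=> Tz.
      by rewrite -[y](subrK x) -addrA -opprB addrC; apply: submodule_sub.
    by rewrite -(subrK y x) -addrA; case: sT => _ TD _; apply: TD.
  - by apply/asboolP; rewrite subrr; case: sT.
  - by apply/asboolP; rewrite -opprB; apply: submodule_opp.
rewrite -(subrK (coset_repr x) x) -addrA; case: (sT) => _ TD _; apply: TD.
  exact: coset_reprP.
by rewrite eq_xy -opprB; exact: (submodule_opp sT (coset_reprP _)).
Qed.

Lemma coset_repr_id x : coset_repr (coset_repr x) = coset_repr x.
Proof.
apply/coset_repr_eq; rewrite -opprB; exact: (submodule_opp sT (coset_reprP _)).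
Qed.

(** The proof that [T] is a submodule is an argument so that the module structure
    below, which depends on it, can be found from the type. *)
Definition quotient_of (_ : submodule T) := {x : M | coset_repr x == x}.
Local Notation quotient := (quotient_of sT).
HB.instance Definition _ := Choice.on quotient.

Definition quot_proj (x : M) : quotient :=
  exist _ (coset_repr x) (introT eqP (coset_repr_id x)).

Lemma quot_projK (x : quotient) : quot_proj (sval x) = x.
Proof. by apply: val_inj; rewrite /= (eqP (valP x)). Qed.

Lemma quot_projP x y : T (x - y) <-> quot_proj x = quot_proj y.
Proof.
rewrite coset_repr_eq; split=> [eq_xy|[]//].
exact: val_inj.
Qed.

Lemma sval_quot_proj x : T (sval (quot_proj x) - x).
Proof. rewrite -opprB; exact: (submodule_opp sT (coset_reprP _)). Qed.

Definition quot_add (x y : quotient) := quot_proj (sval x + sval y).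
Definition quot_opp (x : quotient) := quot_proj (- sval x).
Definition quot_scale (a : R) (x : quotient) := quot_proj (a *: sval x).

Lemma quot_proj_add x y : quot_add (quot_proj x) (quot_proj y) = quot_proj (x + y).
Proof.
apply/quot_projP; rewrite opprD addrACA; case: (sT) => _ TD _.
by apply: TD; apply: sval_quot_proj.
Qed.

Lemma quot_proj_opp x : quot_opp (quot_proj x) = quot_proj (- x).
Proof.
apply/quot_projP; rewrite -opprD; apply: (submodule_opp sT).
exact: sval_quot_proj.
Qed.

Lemma quot_proj_scale a x : quot_scale a (quot_proj x) = quot_proj (a *: x).
Proof.
apply/quot_projP; rewrite -scalerBr; case: (sT) => _ _ TZ.
exact/TZ/sval_quot_proj.
Qed.

Fact quot_addA : associative quot_add.
Proof.
move=> x y z; rewrite -[x]quot_projK -[y]quot_projK -[z]quot_projK.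
by rewrite !quot_proj_add addrA.
Qed.
Fact quot_addC : commutative quot_add.
Proof. by move=> x y; rewrite /quot_add addrC. Qed.
Fact quot_add0 : left_id (quot_proj 0) quot_add.
Proof. by move=> x; rewrite -[x]quot_projK quot_proj_add add0r. Qed.
Fact quot_addN : left_inverse (quot_proj 0) quot_opp quot_add.
Proof.
by move=> x; rewrite -[x]quot_projK quot_proj_opp quot_proj_add addNr.
Qed.
HB.instance Definition _ :=
  GRing.isZmodule.Build quotient quot_addA quot_addC quot_add0 quot_addN.

Fact quot_scaleA a b (x : quotient) :
  quot_scale a (quot_scale b x) = quot_scale (a * b) x.
Proof. by rewrite -[x]quot_projK !quot_proj_scale scalerA. Qed.
Fact quot_scale1 : left_id 1 quot_scale.
Proof. by move=> x; rewrite -[x]quot_projK quot_proj_scale scale1r. Qed.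
Fact quot_scaleDr : right_distributive quot_scale +%R.
Proof.
move=> a x y; rewrite -[x]quot_projK -[y]quot_projK.
rewrite -[LHS]/(quot_scale _ (quot_add _ _)).
by rewrite -[RHS]/(quot_add _ _) !(quot_proj_scale, quot_proj_add) scalerDr.
Qed.
Fact quot_scaleDl (x : quotient) : {morph quot_scale^~ x : a b / a + b}.
Proof.
move=> a b; rewrite -[x]quot_projK -[RHS]/(quot_add _ _).
by rewrite !(quot_proj_scale, quot_proj_add) scalerDl.
Qed.
HB.instance Definition _ :=
  GRing.Zmodule_isLmodule.Build R quotient
    quot_scaleA quot_scale1 quot_scaleDr quot_scaleDl.

Fact quot_proj_linear : linear quot_proj.
Proof. by move=> a x y; rewrite -quot_proj_add -quot_proj_scale; reflexivity. Qed.
HB.instance Definition _ :=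
  GRing.isLinear.Build R M quotient *:%R quot_proj quot_proj_linear.

End Quotient.

Lemma quotient_exists M (T : set M) : submodule T ->
  exists (X : lmodType R) (p : {linear M -> X}),
    surj p /\ forall x, p x = 0 <-> T x.
Proof.
move=> sT; exists (quotient_of sT : lmodType R), (quot_proj sT).
split=> [x|x]; first by exists (sval x); apply: quot_projK.
rewrite -[x in T x]subr0; exact: iff_sym (quot_projP sT x 0).
Qed.

Lemma fin_gen_finite M (I : finType) (g : I -> M) :
  (forall x, exists c : I -> R, x = \sum_i c i *: g i) -> fin_gen M.
Proof.
move=> gP; exists #|I|, (g \o enum_val) => x; have [c ->] := gP x.
by exists (c \o enum_val); rewrite -(big_enum_val (fun i => c i *: g i)).
Qed.

Lemma fin_gen_image M N (f : {linear M -> N}) : surj f -> fin_gen M -> fin_gen N.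
Proof.
move=> f_surj [n [g gP]]; exists n, (f \o g) => y.
have [x <-] := f_surj y; have [c ->] := gP x; exists c.
by rewrite linear_sum; apply: eq_bigr => i _; rewrite linearZ.
Qed.

Lemma fin_gen_power M n : fin_gen M -> fin_gen {ffun 'I_n -> M}.
Proof.
case=> r [g gP].
apply: (@fin_gen_finite _ ('I_n * 'I_r)%type
  (fun u => [ffun i => if i == u.1 then g u.2 else 0])) => x.
have [c cP] := choice (fun i => gP (x i)).
exists (fun u => c u.1 u.2); apply/ffunP => i; rewrite sum_ffunE.
under eq_bigr do rewrite !ffunE.
rewrite -(pair_big xpredT xpredT
  (fun k l => c k l *: (if i == k then g l else 0))) /=.
rewrite (bigD1 i) //= eqxx -cP big1 ?addr0 // => k /negbTE ki.
by rewrite big1 // => l _; rewrite eq_sym ki scaler0.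
Qed.

End Generalities.

(** * The functor Hom(P, -) *)

Section HomFunctor.
Import GRing.Theory.
Local Open Scope ring_scope.
Local Open Scope classical_set_scope.
Variables (R : pzRingType) (P : lmodType R).
Implicit Types (M N Q X Y : lmodType R).

Lemma linear_ext M N (f g : {linear M -> N}) : f =1 g -> f = g.
Proof.
case: f g => f [[fD] [fZ]] [g [[gD] [gZ]]] /= /funext fg.
by case: _ / fg in gD gZ *; rewrite (Prop_irrelevance fD gD) (Prop_irrelevance fZ gZ).
Qed.

Section HomModule.
Variable X : lmodType R.

(** An alias of the type of linear maps, to carry the left module structure over
    End(P)^op given by precomposition. *)
Definition hom := {linear P -> X}.

HB.instance Definition _ := gen_eqMixin hom.
HB.instance Definition _ := gen_choiceMixin hom.

Definition hom_add (h l : hom) : hom := h \+ l.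
Definition hom_opp (h : hom) : hom := -%R \o h.
Definition hom_zero : hom := \0.

Fact hom_addA : associative hom_add.
Proof. by move=> f g h; apply: linear_ext => x /=; rewrite addrA. Qed.
Fact hom_addC : commutative hom_add.
Proof. by move=> f g; apply: linear_ext => x /=; rewrite addrC. Qed.
Fact hom_add0 : left_id hom_zero hom_add.
Proof. by move=> f; apply: linear_ext => x /=; rewrite add0r. Qed.
Fact hom_addN : left_inverse hom_zero hom_opp hom_add.
Proof. by move=> f; apply: linear_ext => x /=; rewrite addNr. Qed.
HB.instance Definition _ :=
  GRing.isZmodule.Build hom hom_addA hom_addC hom_add0 hom_addN.

Definition hom_scale (f : (endo P)^c) (h : hom) : hom :=
  h \o (f : {linear P -> P}).

Fact hom_scaleA (f g : (endo P)^c) (h : hom) :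
  hom_scale f (hom_scale g h) = hom_scale (f * g) h.
Proof. exact: linear_ext. Qed.
Fact hom_scale1 : left_id 1 hom_scale.
Proof. by move=> h; apply: linear_ext. Qed.
Fact hom_scaleDr : right_distributive hom_scale +%R.
Proof. by move=> f g h; apply: linear_ext. Qed.
Fact hom_scaleDl (h : hom) : {morph hom_scale^~ h : f g / f + g}.
Proof. by move=> f g; apply: linear_ext => x; rewrite /= linearD. Qed.
HB.instance Definition _ := GRing.Zmodule_isLmodule.Build (endo P)^c hom
  hom_scaleA hom_scale1 hom_scaleDr hom_scaleDl.

Lemma hom_scaleE (f : (endo P)^c) (h : hom) x :
  (f *: h : hom) x = h ((f : endo P) x).
Proof. by []. Qed.

Lemma hom_sumE (I : Type) (s : seq I) (A : pred I) (h : I -> hom) x :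
  (\sum_(i <- s | A i) h i) x = \sum_(i <- s | A i) h i x.
Proof. by elim/big_ind2: _ => // _ y _ z <- <-. Qed.

End HomModule.

Definition hom_comp M N (f : {linear M -> N}) (h : hom M) : hom N := f \o h.

Fact hom_comp_linear M N (f : {linear M -> N}) : linear (hom_comp f).
Proof. by move=> a h l; apply: linear_ext => x; rewrite /= linearD. Qed.
HB.instance Definition _ M N (f : {linear M -> N}) :=
  GRing.isLinear.Build (endo P)^c (hom M) (hom N) *:%R (hom_comp f)
    (hom_comp_linear f).

End HomFunctor.

(** * Dual bases and lifting *)

Section DualBasis.
Import GRing.Theory.
Local Open Scope ring_scope.
Local Open Scope classical_set_scope.
Variable R : pzRingType.
Implicit Types (M N P Q X Y : lmodType R).

Definition power_coord_fun M N n (h : {linear M -> {ffun 'I_n -> N}}) (i : 'I_n)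
  (x : M) : N := h x i.

Fact power_coord_linear M N n (h : {linear M -> {ffun 'I_n -> N}}) i :
  linear (power_coord_fun h i).
Proof. by move=> a x y; rewrite /power_coord_fun linearP !ffunE. Qed.
HB.instance Definition _ M N n (h : {linear M -> {ffun 'I_n -> N}}) i :=
  GRing.isLinear.Build R M N *:%R (power_coord_fun h i) (power_coord_linear h i).
Definition power_coord M N n (h : {linear M -> {ffun 'I_n -> N}}) i :
  {linear M -> N} := power_coord_fun h i.

Definition to_power M N n (v : 'I_n -> {linear M -> N}) (x : M) :
  {ffun 'I_n -> N} := [ffun i => v i x].

Fact to_power_linear M N n (v : 'I_n -> {linear M -> N}) : linear (to_power v).
Proof. by move=> a x y; apply/ffunP => i; rewrite !ffunE linearP. Qed.
HB.instance Definition _ M N n (v : 'I_n -> {linear M -> N}) :=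
  GRing.isLinear.Build R M {ffun 'I_n -> N} *:%R (to_power v) (to_power_linear v).

Definition lin_comb M n (g : 'I_n -> M) (c : {ffun 'I_n -> R^o}) : M :=
  \sum_(i < n) (c i : R) *: g i.

Fact lin_comb_linear M n (g : 'I_n -> M) : linear (lin_comb g).
Proof.
move=> a c d; rewrite /lin_comb scaler_sumr -big_split; apply: eq_bigr => i _.
by rewrite !ffunE scalerDl scalerA.
Qed.
HB.instance Definition _ M n (g : 'I_n -> M) :=
  GRing.isLinear.Build R {ffun 'I_n -> R^o} M *:%R (lin_comb g)
    (lin_comb_linear g).

Definition rank1 M N (phi : {linear M -> R^o}) (y : N) (x : M) : N :=
  (phi x : R) *: y.

Fact rank1_linear M N (phi : {linear M -> R^o}) (y : N) : linear (rank1 phi y).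
Proof. by move=> a x z; rewrite /rank1 linearP scalerDl scalerA. Qed.
HB.instance Definition _ M N (phi : {linear M -> R^o}) (y : N) :=
  GRing.isLinear.Build R M N *:%R (rank1 phi y) (rank1_linear phi y).

Definition power_inj M n (i : 'I_n) (x : M) : {ffun 'I_n -> M} :=
  [ffun j => if j == i then x else 0].

Fact power_inj_linear M n (i : 'I_n) : linear (@power_inj M n i).
Proof.
move=> a x z; apply/ffunP => j; rewrite !ffunE.
by case: (j == i); rewrite // scaler0 addr0.
Qed.
HB.instance Definition _ M n (i : 'I_n) :=
  GRing.isLinear.Build R M {ffun 'I_n -> M} *:%R (@power_inj M n i)
    (@power_inj_linear M n i).

Lemma power_sum M n (y : {ffun 'I_n -> M}) : \sum_(i < n) power_inj i (y i) = y.
Proof.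
apply/ffunP => j; rewrite sum_ffunE (bigD1 j) //= ffunE eqxx.
by rewrite big1 ?addr0 // => i /negbTE ij; rewrite ffunE eq_sym ij.
Qed.

Lemma projective_power P n : projective P -> projective {ffun 'I_n -> P}.
Proof.
move=> proj_P M N g f g_surj.
have [l lP] := choice (fun i : 'I_n =>
  proj_P _ _ g (f \o @power_inj P n i : {linear P -> N}) g_surj).
exists (\sum_(i < n) (l i \o power_coord idfun i : hom {ffun 'I_n -> P} M)) => x.
rewrite hom_sumE -[in RHS](power_sum x) !linear_sum.
by apply: eq_bigr => i _; apply: lP.
Qed.

(** Over a noncommutative ring, multiplying the values of a functional on the
    right is what keeps it linear. *)
Definition functional_mulr M (phi : {linear M -> R^o}) (a : R) (x : M) : R^o :=
  (phi x : R) * a.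
Fact functional_mulr_linear M (phi : {linear M -> R^o}) a :
  linear (functional_mulr phi a).
Proof. by move=> b x y; rewrite /functional_mulr linearP mulrDl /= -mulrA. Qed.
HB.instance Definition _ M (phi : {linear M -> R^o}) (a : R) :=
  GRing.isLinear.Build R M R^o *:%R (functional_mulr phi a)
    (functional_mulr_linear phi a).

Definition dual_basis M n (e : 'I_n -> M) (phi : 'I_n -> {linear M -> R^o}) :=
  forall x, x = \sum_(i < n) (phi i x : R) *: e i.

(** The functionals are the coordinates of a section of a surjection from a free
    module. *)
Lemma dual_basis_exists P : fin_gen P -> projective P ->
  exists n (e : 'I_n -> P) (phi : 'I_n -> {linear P -> R^o}), dual_basis e phi.
Proof.
case=> n [e eP] proj_P.
have e_surj : surj (lin_comb e).
  move=> x; have [c ->] := eP x; exists [ffun i => c i].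
  by apply: eq_bigr => i _; rewrite ffunE.
have [h hK] := proj_P _ _ (lin_comb e) idfun e_surj.
by exists n, e, (power_coord h) => x; rewrite -[LHS]hK.
Qed.

(** Lifts through a map [s] that need not be onto, provided the values of [h] lie
    in its image: with a dual basis it suffices to lift the values on the [e i],
    and the image of [s] never has to be made into a module. *)
Lemma lift_exact P M N (s : {linear M -> N}) (h : {linear P -> N}) :
  fin_gen P -> projective P -> (forall x, exists y, s y = h x) ->
  exists l : {linear P -> M}, forall x, s (l x) = h x.
Proof.
move=> fgP proj_P hs.
have [n [e [phi eP]]] := dual_basis_exists fgP proj_P.
have [q qP] := choice (fun i => hs (e i)).
exists (\sum_(i < n) (rank1 (phi i) (q i) : hom P M)) => x.
rewrite hom_sumE [in RHS](eP x) !linear_sum; apply: eq_bigr => i _.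
by rewrite !linearZ qP.
Qed.

End DualBasis.

(** * Modules generated by P and projective covers *)

Section Trace.
Import GRing.Theory.
Local Open Scope ring_scope.
Local Open Scope classical_set_scope.
Variables (R : pzRingType) (P : lmodType R).
Implicit Types (M N Q X Y : lmodType R).

(** The submodule generated by the images of the maps in [K], as the intersection
    of the submodules containing them; this form makes membership usable as an
    induction principle. *)
Definition trace M (K : set (hom P M)) : set M := fun y =>
  forall N : set M, submodule N -> (forall h, K h -> forall x, N (h x)) -> N y.

Lemma submodule_trace M (K : set (hom P M)) : submodule (trace K).
Proof.
split=> [|y z Ky Kz|a y Ky] N sN KN; case: (sN) => // N0 ND NZ.
  by apply: ND; [apply: Ky | apply: Kz].
by apply: NZ; apply: Ky.
Qed.

Lemma trace_in M (K : set (hom P M)) h x : K h -> trace K (h x).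
Proof. by move=> Kh N _; apply. Qed.

Definition generated M : Prop := forall y : M, trace setT y.

Lemma generated_image M N (f : {linear M -> N}) :
  surj f -> generated M -> generated N.
Proof.
move=> f_surj genM y A sA A_in; have [x <-] := f_surj y.
apply: (genM x (f @^-1` A)); first exact: submodule_preim.
by move=> h _ z; apply: (A_in (hom_comp f h)).
Qed.

Lemma generated_power n : generated {ffun 'I_n -> P}.
Proof.
move=> y A sA A_in; rewrite -[y]power_sum.
by apply: submodule_sum => // i; apply: A_in.
Qed.

(** Maps [P -> X] lift to [Q], so the trace of [P] in [Q] maps onto [X]; together
    with the superfluous kernel of [g] it then spans [Q]. *)
Lemma cover_generated Q X (g : {linear Q -> X}) : projective P ->
  projective_cover g -> generated X -> generated Q.
Proof.
move=> proj_P [_ _ g_surj sup] genX.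
apply: sup; first exact: submodule_trace.
move=> y.
have : [set x | exists2 z, trace setT z & g z = x] (g y).
  apply: genX; first exact/submodule_image/submodule_trace.
  move=> h _ x; have [l lh] := proj_P _ _ g h g_surj.
  by exists (l x); [exact: trace_in|].
case=> z Tz gz; exists z, (y - z); split => //=.
  by rewrite linearB gz subrr.
by rewrite addrC subrK.
Qed.

(** The pairs [(u, v)] in the list are the components of maps from [M] to a power
    of [P] and from it to [N].  For the identity of [Q], this says that [Q] is in
    add P. *)
Definition factors_through_power M N (f : M -> N) : Prop :=
  exists s : seq (hom P N * hom M P), forall x, f x = \sum_(uv <- s) uv.1 (uv.2 x).

Lemma factors_add M N (f g : M -> N) :
  factors_through_power f -> factors_through_power g ->
  factors_through_power (fun x => f x + g x).
Proof.
case=> s fs [t gt]; exists (s ++ t) => x.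
by rewrite big_cat fs gt.
Qed.

Lemma factors_zero M N : factors_through_power (fun _ : M => 0 : N).
Proof. by exists [::] => x; rewrite big_nil. Qed.

(** The identity of [Q] is a sum of rank one maps [z |-> psi z *: y].  The [y] for
    which these factor for every [psi] form a submodule, which contains each
    [h x] with [h] from [P] to [Q], the map [z |-> psi z *: x] being the other
    factor; so it is all of [Q]. *)
Lemma generated_factors_through_power Q : fin_gen Q -> projective Q -> generated Q ->
  factors_through_power (@id Q).
Proof.
move=> fgQ proj_Q genQ.
have [n [e [phi eP]]] := dual_basis_exists fgQ proj_Q.
have rank1_factors (psi : {linear Q -> R^o}) (y : Q) :
    factors_through_power (rank1 psi y).
  pose A : set Q := [set y : Q |
    forall psi : {linear Q -> R^o}, factors_through_power (rank1 psi y)].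
  suff: A y by apply.
  apply: (genQ y A) => [|h _ x {}psi].
    split=> [{}psi|z t Az At {}psi|a z Az {}psi].
    - have [s sP] := factors_zero Q Q.
      by exists s => x; rewrite -sP /rank1 scaler0.
    - have [s sP] := factors_add (Az psi) (At psi).
      by exists s => x; rewrite -sP /rank1 scalerDr.
    - have [s sP] := Az (functional_mulr psi a).
      by exists s => x; rewrite -sP /rank1 scalerA.
  exists [:: (h, (rank1 psi x : hom Q P))] => z.
  by rewrite big_seq1 /= /rank1 linearZ.
have [s sP] : factors_through_power (fun x => \sum_(i < n) rank1 (phi i) (e i) x).
  elim: (index_enum _) => [|i r IHr].
    by have [s sP] := factors_zero Q Q; exists s => x; rewrite big_nil.
  have [s sP] := factors_add (rank1_factors (phi i) (e i)) IHr.
  by exists s => x; rewrite big_cons.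
by exists s => x; rewrite -sP; apply: eP.
Qed.

(** If the identity of [Q] is the sum of the [u \o v], then [h] is the sum of the
    [u \o (v \o h)], a combination of the maps [u] with coefficients [v \o h] in
    End(P)^op. *)
Lemma hom_fin_gen Q : factors_through_power (@id Q) -> fin_gen (hom P Q).
Proof.
case=> s sP; exists (size s), (fun i => (tnth (in_tuple s) i).1) => h.
exists (fun i => ((tnth (in_tuple s) i).2 \o h : hom P P)).
by apply: linear_ext => x; rewrite hom_sumE [LHS]sP big_tnth.
Qed.

(** By the same formula the [u] and the operators [h |-> v \o h] form a dual basis
    of Hom(P, Q), and a lift is determined by choosing it on each [u]. *)
Lemma hom_projective Q : factors_through_power (@id Q) -> projective (hom P Q).
Proof.
case=> s sP M N g f g_surj; have [q gq] := choice g_surj.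
pose F (h : hom P Q) : M :=
  \sum_(uv <- s) ((uv.2 \o h : hom P P) : (endo P)^c) *: q (f uv.1).
have F_lin : linear F.
  move=> a h l; rewrite /F scaler_sumr -big_split; apply: eq_bigr => uv _ /=.
  rewrite scalerA -scalerDl; congr (_ *: _); apply: linear_ext => x /=.
  by rewrite linearD.
pose G : {linear hom P Q -> M} := HB.pack F (GRing.isLinear.Build _ _ _ _ F F_lin).
exists G => h /=.
rewrite linear_sum.
have hE : h = \sum_(uv <- s) ((uv.2 \o h : hom P P) : (endo P)^c) *: uv.1.
  by apply: linear_ext => x; rewrite hom_sumE [LHS]sP.
rewrite [in RHS]hE linear_sum; apply: eq_bigr => uv _.
by rewrite !linearZ gq.
Qed.

Hypotheses (fgP : fin_gen P) (proj_P : projective P).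

(** A submodule of Hom(P, M) is determined by the submodule of [M] that it
    generates.  The [y] for which all maps [x |-> psi x *: y] are in [K] form a
    submodule containing the images of the maps in [K], because [psi _ *: l x] is
    the composite of [l] with the endomorphism [psi _ *: x] of [P]; so it contains
    the values of [h], and [h] is a sum of such rank one maps. *)
Lemma trace_hom M (K : set (hom P M)) (h : hom P M) :
  submodule K -> (forall x, trace K (h x)) -> K h.
Proof.
move=> sK hK; have [K0 KD KZ] := sK.
have [n [e [phi eP]]] := dual_basis_exists fgP proj_P.
pose A := [set y : M | forall psi : {linear P -> R^o}, K (rank1 psi y : hom P M)].
have sA : submodule A.
  split=> [psi|y z Ay Az psi|a y Ay psi].
  - suff -> : (rank1 psi 0 : hom P M) = 0 by [].
    by apply: linear_ext => x; apply: scaler0.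
  - have -> : (rank1 psi (y + z) : hom P M) =
        (rank1 psi y : hom P M) + (rank1 psi z : hom P M).
      by apply: linear_ext => x; apply: scalerDr.
    exact: KD.
  - have -> : (rank1 psi (a *: y) : hom P M) =
        (rank1 (functional_mulr psi a) y : hom P M).
      by apply: linear_ext => x; apply: scalerA.
    exact: Ay.
have -> : h = \sum_(i < n) (rank1 (phi i) (h (e i)) : hom P M).
  apply: linear_ext => x; rewrite hom_sumE [in LHS](eP x) linear_sum.
  by apply: eq_bigr => i _; rewrite linearZ.
apply: submodule_sum => // i; apply: (hK (e i) A) => // l Kl x psi.
have -> : (rank1 psi (l x) : hom P M) = ((rank1 psi x : hom P P) : (endo P)^c) *: l.
  by apply: linear_ext => y; rewrite hom_scaleE linearZ.
exact: KZ.
Qed.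

Lemma hom_exact M N X (f : {linear M -> N}) (g : {linear N -> X}) :
  exact_at f g ->
  exact_at (hom_comp f : {linear hom P M -> hom P N})
           (hom_comp g : {linear hom P N -> hom P X}).
Proof.
move=> ex h; split=> [gh0|[l <-]].
  have hf x : exists y, f y = h x.
    by apply/ex; rewrite -[g _]/(hom_comp g h x) gh0.
  have [l lP] := lift_exact fgP proj_P hf.
  by exists l; apply: linear_ext.
by apply: linear_ext => x; apply/ex; exists (l x).
Qed.

Lemma hom_surj M N (f : {linear M -> N}) :
  surj f -> surj (hom_comp f : hom P M -> hom P N).
Proof.
move=> f_surj h; have [l lP] := proj_P h f_surj.
by exists l; apply: linear_ext.
Qed.

Lemma hom_inj M N (f : {linear M -> N}) :
  injective f -> injective (hom_comp f : hom P M -> hom P N).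
Proof.
move=> f_inj h l /(congr1 (fun u : hom P N => u : P -> N)) hl.
by apply: linear_ext => x; apply: f_inj; apply: (congr1 (@^~ x) hl).
Qed.

(** For superfluousness, let [N] and the kernel of [hom_comp g] span Hom(P, Q).
    Then the trace of [N] and the kernel of [g] span [Q], because [Q] is generated
    by the values of maps from [P]; so the trace of [N] is [Q], and [trace_hom]
    puts every map in [N]. *)
Lemma hom_cover Q X (g : {linear Q -> X}) :
  projective_cover g -> generated X ->
  projective_cover (hom_comp g : {linear hom P Q -> hom P X}).
Proof.
move=> cov genX; have [fgQ proj_Q g_surj sup] := cov.
have genQ := cover_generated proj_P cov genX.
have facQ := generated_factors_through_power fgQ proj_Q genQ.
split; [exact: hom_fin_gen | exact: hom_projective | exact: hom_surj |].
move=> N sN decomp h; apply: trace_hom => // x; move: {h x}(h x).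
apply: sup; first exact: submodule_trace.
move=> y.
have : [set y | exists a b, [/\ trace N a, g b = 0 & y = a + b]] y.
  apply: genQ => [|h _ x].
    split=> [|_ _ [a [b [Na gb ->]]] [c [d [Nc gd ->]]]|r _ [a [b [Na gb ->]]]].
    - exists 0, 0; rewrite linear0 addr0; split=> //.
      by case: (submodule_trace N).
    - exists (a + c), (b + d); rewrite linearD gb gd addr0 addrACA; split=> //.
      by case: (submodule_trace N) => _ D _; apply: D.
    - exists (r *: a), (r *: b); rewrite linearZ /= gb scaler0 scalerDr; split=> //.
      by case: (submodule_trace N) => _ _; apply.
  have [a [b [Na gb ->]]] := decomp h.
  exists (a x), (b x); split=> //; first exact: trace_in.
  exact: (congr1 (fun u : hom P X => u x) gb).
by [].
Qed.

End Trace.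

(** * Presenting modules over End(P)^op *)

Section Presentation.
Import GRing.Theory.
Local Open Scope ring_scope.
Local Open Scope classical_set_scope.
Variables (R : pzRingType) (P : lmodType R).
Implicit Types (M Q X Y K V W : lmodType R) (N : lmodType (endo P)^c).

(** Besides Hom(P, X) being [N], the module [X] is asked to be a quotient of a
    power of [P] by a [P]-generated kernel, which is what makes [X] and its first
    syzygy generated by [P]. *)
Definition presents X N : Prop :=
  isomorphic (hom P X) N /\
  exists n (p : {linear {ffun 'I_n -> P} -> X}),
    surj p /\ forall z, p z = 0 -> trace [set h : hom P _ | hom_comp p h = 0] z.

Lemma hom_isomorphic X Y : isomorphic X Y -> isomorphic (hom P X) (hom P Y).
Proof.
case=> f [g fK gK].
have g_lin : linear g.
  by move=> a x y; apply: (can_inj fK); rewrite linearP !gK.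
pose G : {linear Y -> X} := HB.pack g (GRing.isLinear.Build _ _ _ _ _ g_lin).
exists (hom_comp f); exists (hom_comp G) => h; apply: linear_ext => x /=.
  exact: fK.
exact: gK.
Qed.

Lemma presents_isomorphic X Y N : isomorphic Y X -> presents X N -> presents Y N.
Proof.
move=> isoYX [isoN [n [p [p_surj kerp]]]]; split.
  exact: isomorphic_trans (hom_isomorphic isoYX) isoN.
have [f [g fK gK]] := isomorphic_sym isoYX.
exists n, (f \o p); split=> [y|z fpz0].
  by have [x px] := p_surj (g y); exists x; rewrite /= px gK.
have kerfp x : f x = 0 -> x = 0.
  by rewrite -{1}(linear0 f) => /(can_inj fK).
move=> A sA A_in; apply: (kerp z (kerfp _ fpz0) A) => // h ph0; apply: A_in.
apply: linear_ext => x; rewrite -[RHS](linear0 f).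
exact: (congr1 (fun u : hom P X => f (u x)) ph0).
Qed.

Hypotheses (fgP : fin_gen P) (proj_P : projective P).

(** The surjection [p] from a power of [P] to [X] lifts to a surjection [f] onto the
    cover [Q], so [f] maps the kernel of [p] onto the kernel of [g]; the former is
    generated by images of [P]. *)
Lemma cover_kernel_generated X N Q K (g : {linear Q -> X}) (i : {linear K -> Q}) :
  presents X N -> projective_cover g -> injective i -> exact_at i g ->
  generated P K.
Proof.
move=> [_ [n [p [p_surj kerp]]]] cov i_inj ex.
have [_ _ g_surj sup] := cov.
have [f fP] := projective_power proj_P p g_surj.
have f_surj : surj f.
  apply: (surj_of_cover_comp sup) => x; have [z <-] := p_surj x.
  by exists z; apply: fP.
move=> y A sA A_in; have [z fz] := f_surj (i y).
(* Argue on z rather than y: it is the kernel of p that is known to be generated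
   by images of P. *)
have [z' Az' fz'] : [set z | exists2 y, A y & i y = f z] z.
  apply: kerp.
  - by rewrite -fP fz; apply/ex; exists y.
  - case: sA => A0 AD AZ; split=> [|u v [a Aa ia] [b Ab ib]|r u [a Aa ia]].
    + by exists 0; rewrite ?linear0.
    + by exists (a + b); [exact: AD | rewrite !linearD ia ib].
    + by exists (r *: a); [exact: AZ | rewrite !linearZ ia].
  - move=> h ph0 x.
    have [l il] : exists l, hom_comp i l = hom_comp f h.
      apply/(hom_exact fgP proj_P ex); rewrite -ph0; apply: linear_ext => u.
      exact: fP.
    by exists (l x); [exact: A_in | exact: (congr1 (fun u : hom P Q => u x) il)].
by move: fz'; rewrite fz => /i_inj <-.
Qed.

(** [X] is the quotient of a power of [P] by the trace of the kernel of the
    surjection [Q] determined by generators of [N]; by [trace_hom] the maps from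
    [P] with values in this trace are exactly those in the kernel. *)
Lemma presentation_exists N : fin_gen N ->
  exists X : lmodType R, fin_gen X /\ presents X N.
Proof.
case=> n [g gP].
pose q (h : hom P {ffun 'I_n -> P}) : N :=
  \sum_(i < n) ((power_coord h i : endo P) : (endo P)^c) *: g i.
have q_lin : linear q.
  move=> a h l; rewrite /q scaler_sumr -big_split; apply: eq_bigr => i _ /=.
  rewrite scalerA -scalerDl; congr (_ *: _); apply: linear_ext => x /=.
  by rewrite /power_coord_fun ffunE.
pose Q : {linear hom P {ffun 'I_n -> P} -> N} :=
  HB.pack q (GRing.isLinear.Build _ _ _ _ _ q_lin).
have Q_surj : surj Q.
  move=> x; have [c ->] := gP x.
  exists (to_power (fun i => c i : endo P) : {linear P -> _}).
  apply: eq_bigr => i _; congr (_ *: _); apply: linear_ext => y.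
  exact: ffunE.
pose K := [set h | Q h = 0].
have sK : submodule K by exact: submodule_kernel.
have [X [p [p_surj kerp]]] := quotient_exists (submodule_trace K).
exists X; split; first exact: fin_gen_image p_surj (fin_gen_power _ fgP).
have ker_Q h : hom_comp p h = 0 <-> Q h = 0.
  split=> [ph0|Kh].
    apply: (trace_hom fgP proj_P sK) => x; apply/kerp.
    exact: (congr1 (fun u : hom P X => u x) ph0).
  by apply: linear_ext => x; apply/kerp; apply: trace_in.
split; first exact: (linear_factor_kernel (hom_surj proj_P p_surj) Q_surj ker_Q).
exists n, p; split=> // z /kerp Tz A sA A_in; apply: (Tz A) => // h /ker_Q.
exact: A_in.
Qed.

Lemma hom_power V n :
  isomorphic (hom P {ffun 'I_n -> V}) {ffun 'I_n -> hom P V}.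
Proof.
pose F (h : hom P {ffun 'I_n -> V}) : {ffun 'I_n -> hom P V} :=
  [ffun i => power_coord h i : hom P V].
have F_lin : linear F.
  move=> a h l; apply/ffunP => i; rewrite !ffunE; apply: linear_ext => x /=.
  by rewrite /power_coord_fun !ffunE.
pose F' : {linear hom P {ffun 'I_n -> V} -> {ffun 'I_n -> hom P V}} :=
  HB.pack F (GRing.isLinear.Build _ _ _ _ _ F_lin).
apply: (@linear_bij_isomorphic _ _ _ F') => [h l /ffunP Fhl|v].
  apply: linear_ext => x; apply/ffunP => i; have := Fhl i; rewrite !ffunE.
  exact: (congr1 (fun u : hom P V => u x)).
exists (to_power v : {linear P -> _}).
by apply/ffunP => i; rewrite ffunE; apply: linear_ext => x; apply: ffunE.
Qed.

Lemma hom_pair X Y : isomorphic (hom P X * hom P Y)%type (hom P (X * Y)%type).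
Proof.
have pair_lin (u : hom P X * hom P Y) :
    linear (fun x => (u.1 x, u.2 x) : (X * Y)%type).
  by move=> a x y /=; rewrite !linearP.
pose F (u : hom P X * hom P Y) : hom P (X * Y)%type :=
  HB.pack (fun x => (u.1 x, u.2 x) : (X * Y)%type)
    (GRing.isLinear.Build _ _ _ _ _ (pair_lin u)).
have F_lin : linear F.
  by move=> a u v; apply: linear_ext.
pose F' : {linear (hom P X * hom P Y)%type -> hom P (X * Y)%type} :=
  HB.pack F (GRing.isLinear.Build _ _ _ _ _ F_lin).
apply: (@linear_bij_isomorphic _ _ _ F') => [[a b] [c d] Fab|h].
  have E x := congr1 (fun u : hom P (X * Y)%type => u x) Fab.
  by congr (_, _); apply: linear_ext => x; case: (E x).
exists ((fst \o h : hom P X), (snd \o h : hom P Y)).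
by apply: linear_ext => x /=; case: (h x).
Qed.

Lemma hom_in_add V X : in_add V X -> in_add (hom P V) (hom P X).
Proof.
case=> n [Y isoXY]; exists n, (hom P Y).
apply: isomorphic_trans (hom_pair X Y) _.
exact: isomorphic_trans (hom_isomorphic isoXY) (hom_power V n).
Qed.

Lemma hom_add_resolution m V X :
  add_resolution m V X -> add_resolution m (hom P V) (hom P X).
Proof.
case=> W [d [e [addW W0 e_surj ex0 ex]]].
exists (fun i => hom P (W i)), (fun i => hom_comp (d i)), (hom_comp e); split.
- by move=> i im; apply/hom_in_add/addW.
- by move=> i mi h; apply: linear_ext => x; rewrite (W0 i mi (h x)).
- exact: hom_surj.
- exact: hom_exact.
- by move=> i; apply: hom_exact.
Qed.

(** The successive covers can be transported as long as the covered modules are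
    generated by [P]; this is known for [X] and for its first syzygy. *)
Lemma hom_syzygy j X N K : j \in [:: 0; 1; 2]%N -> presents X N ->
  is_syzygy j X K -> is_syzygy j N (hom P K).
Proof.
have syz0 Y K' N' : presents Y N' -> is_syzygy 0 Y K' -> presents K' N'.
  by move=> presY isoKY; apply: presents_isomorphic presY.
have syz1 Y K' N' : presents Y N' -> is_syzygy 1 Y K' ->
    is_syzygy 1 N' (hom P K') /\ generated P K'.
  move=> presY [Y' [Q [g [i [/(syz0 _ _ _ presY) presY' cov i_inj ex]]]]].
  split; last exact: cover_kernel_generated presY' cov i_inj ex.
  exists (hom P Y'), (hom P Q), (hom_comp g), (hom_comp i); split.
  - by case: presY'.
  - apply: hom_cover => //; have [_ [n [p [p_surj _]]]] := presY'.
    exact: generated_image p_surj (@generated_power _ _ n).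
  - exact: hom_inj.
  - exact: hom_exact.
rewrite !inE => /or3P[] /eqP-> presX.
- by move=> /(syz0 _ _ _ presX)[].
- by move=> /(syz1 _ _ _ presX)[].
case=> Y [Q [g [i [/(syz1 _ _ _ presX)[syzY genY] cov i_inj ex]]]].
exists (hom P Y), (hom P Q), (hom_comp g), (hom_comp i); split=> //.
- exact: hom_cover.
- exact: hom_inj.
- exact: hom_exact.
Qed.

End Presentation.

(** * Finiteness over the base ring *)

Section Scalars.
Import GRing.Theory.
Local Open Scope ring_scope.
Variables (k : comPzRingType) (A : algebra k) (P : lmodType A).

(** With [v] generating [V] over [A] and [g] generating [A] over [k], the rank one
    maps [x |-> phi i x *: (g a *: v j)] generate Hom(P, V): scalars from [k] are
    central, so they move past [phi i] to act on [x]. *)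
Lemma hom_finite_over_base V : artin_algebra A -> fin_gen P -> projective P ->
  fin_gen V -> exists (n : nat) (t : 'I_n -> hom P V),
    forall h, exists c : 'I_n -> k, h = \sum_(i < n) endo_op_map P (c i) *: t i.
Proof.
case=> _ [r [g gP]] fgP proj_P [l [v vP]].
have [n [e [phi eP]]] := dual_basis_exists fgP proj_P.
pose I := ('I_n * ('I_l * 'I_r))%type.
pose t (u : I) : hom P V := rank1 (phi u.1) (g u.2.2 *: v u.2.1).
exists #|{: I}|, (t \o enum_val) => h.
have [b bP] := choice (fun i => vP (h (e i))).
have [c cP] := choice (fun u : 'I_n * 'I_l => gP (b u.1 u.2)).
exists (fun i => let u := enum_val i in c (u.1, u.2.1) u.2.2).
rewrite -(big_enum_val (fun u : I => endo_op_map P (c (u.1, u.2.1) u.2.2) *: t u)).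
apply: linear_ext => x; rewrite hom_sumE [in LHS](eP x) linear_sum.
rewrite -(pair_big xpredT xpredT (fun i (u : 'I_l * 'I_r) =>
  (endo_op_map P (c (i, u.1) u.2) *: t (i, u) : hom P V) x)) /=.
apply: eq_bigr => i _; rewrite linearZ /= [in LHS]bP scaler_sumr.
rewrite -(pair_big xpredT xpredT (fun j a =>
  (endo_op_map P (c (i, j) a) *: t (i, (j, a)) : hom P V) x)) /=.
apply: eq_bigr => j _; rewrite [in LHS](cP (i, j)) /= scaler_suml scaler_sumr.
apply: eq_bigr => a _.
by rewrite /rank1 /endo_op_map_fun linearZ /= !scalerA mulrA -alg_mapC.
Qed.

Lemma endo_op_artin : artin_algebra A -> fin_gen P -> projective P ->
  artin_algebra (endo_op P).
Proof.
move=> artA fgP proj_P.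
have [n [t tP]] := hom_finite_over_base artA fgP proj_P fgP.
split; first by case: artA.
by exists n, t => a; have [c ->] := tP a; exists c.
Qed.

Lemma hom_fin_gen_artin V : artin_algebra A -> fin_gen P -> projective P ->
  fin_gen V -> fin_gen (hom P V).
Proof.
move=> artA fgP proj_P fgV.
have [n [t tP]] := hom_finite_over_base artA fgP proj_P fgV.
by exists n, t => h; have [c ->] := tP h; exists (fun i => endo_op_map P (c i)).
Qed.

End Scalars.

Theorem theorem1p1 (k : comPzRingType) (Lambda : algebra k)
    (P : lmodType Lambda) (m j : nat)
    (artin_Lambda : artin_algebra Lambda)
    (fg_P : fin_gen P) (proj_P : projective P)
    (j012 : j \in [:: 0; 1; 2]) :
  igusa_todorov m j Lambda -> igusa_todorov m j (endo_op P).
Proof.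
case=> _ [V [fgV resV]]; split; first exact: endo_op_artin.
exists (hom P V); split=> [|N fgN]; first exact: hom_fin_gen_artin.
have [X [fgX presX]] := presentation_exists fg_P proj_P fgN.
have [K [syzK resK]] := resV X fgX.
exists (hom P K); split; first exact: hom_syzygy presX syzK.
exact: hom_add_resolution.
Qed.
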